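(* Let $m\ge 1$. For an $(m+1)$-ary tree $T$, define $\mathcal{B}^{(m)}_T(x)$ recursively by $\mathcal{B}^{(m)}_\emptyset:=1$ and $$\mathcal{B}^{(m)}_T:=\mathrm{B}^{(m)}_{y=1}\bigl(\mathcal{B}^{(m)}_{T_L},\mathcal{B}^{(m)}_{T_{R_1}},\dots,\mathcal{B}^{(m)}_{T_{R_m}}\bigr),$$ where $T_L,T_{R_1},\dots,T_{R_m}$ are the subtrees of the root of $T$. Then, for $T$ with $n$ nodes, $\mathcal{B}^{(m)}_T(x)$ counts the elements smaller than or equal to $T$ in the $m$-Tamari lattice $\mathcal{T}_n^{(m)}$ according to the number of nodes on their leftmost branch (equivalently, the number of contacts of their ballot path): it equals $\sum_{T'\le T}x^{\ell(T')}$, where $\ell(T')$ is this statistic. In particular, $\mathcal{B}^{(m)}_T(1)$ is the number of elements smaller than or equal to $T$ in $\mathcal{T}_n^{(m)}$.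
   Context: Operator: $\Delta(g):=\frac{x\,g(x)-g(1)}{x-1}$ for a polynomial $g$ in $x$, and $\mathrm{B}^{(m)}_{y=1}(f,g_1,\dots,g_m):=x\,f\,\Delta(g_1\Delta(g_2\Delta(\cdots\Delta(g_m)\cdots)))$. Trees: binary trees are planar, either empty or a root with an ordered pair (left subtree, right subtree); $x(A,B)$ denotes the tree with root $x$ and left/right subtrees $A,B$. The Tamari order on binary trees of a given size is the reflexive transitive closure of right rotation, which replaces a subtree $y(x(A,B),C)$ by $x(A,y(B,C))$ (the result being greater). An $(m+1)$-ary tree is either empty or a root with an ordered list $(T_L,T_{R_1},\dots,T_{R_m})$ of $(m+1)$-ary trees. $m$-binary trees: a binary tree is an $m$-binary tree if it is empty or is built as follows from $m$-binary trees $T_L,T_{R_1},\dots,T_{R_m}$. Set $G_m:=T_{R_m}$; for $i=m-1,\dots,1$ let $G_i$ be obtained from $T_{R_i}$ by grafting, as the left child of its leftmost node, the tree with a new root node, empty left subtree and right subtree $G_{i+1}$ (if $T_{R_i}$ is empty, $G_i$ is this grafted tree itself); then $T$ is the tree with a new root, left subtree $T_L$ and right subtree $G_1$. An $m$-binary tree has size $nm$ for some $n$. This structure gives a recursive bijection between $m$-binary trees of size $nm$ and $(m+1)$-ary trees with $n$ nodes (the $m$-binary tree composed of $T_L,T_{R_1},\dots,T_{R_m}$ corresponds to the $(m+1)$-ary tree whose subtrees are the images of $T_L,T_{R_1},\dots,T_{R_m}$). The $m$-Tamari lattice $\mathcal{T}_n^{(m)}$ is the set of $m$-binary trees of size $nm$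 ordered by the restriction of the Tamari order; via the bijection it is regarded as an order on $(m+1)$-ary trees with $n$ nodes. The leftmost branch consists of the nodes reached from the root by following only first (leftmost) edges, root included; its number of nodes is the same for an $m$-binary tree and the corresponding $(m+1)$-ary tree. Ballot paths: an $m$-ballot path of size $n$ is a lattice path from $(0,0)$ to $(nm,n)$ with vertical steps $(0,1)$ (letter $1$) and horizontal steps $(1,0)$ (letter $0$) staying weakly above the line $y=x/m$. The path of the empty tree is empty, and the path of the tree with subtrees $T_L,T_{R_1},\dots,T_{R_m}$ is $W_L\,1\,W_{R_m}\,0\,W_{R_{m-1}}\,0\cdots W_{R_1}\,0$, where $W_L,W_{R_j}$ are the paths of $T_L,T_{R_j}$. The number of contacts is the number of contact points with the line $y=x/m$, not counting the starting point. *)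

(* Defs.v *)
From HB Require Import structures.
From mathcomp Require Import all_boot all_order all_algebra.
From mathcomp Require Import boolp.
From Stdlib Require Import Relation_Operators.

Set Implicit Arguments.
Unset Strict Implicit.
Unset Printing Implicit Defensive.

Import Order.TTheory GRing.Theory Num.Theory.
Local Open Scope ring_scope.

Definition Delta (g : {poly int}) : {poly int} :=
  ('X * g - g.[1]%:P) %/ ('X - 1%:P).

(* The division in Delta is exact. *)
Lemma DeltaK (g : {poly int}) : Delta g * ('X - 1%:P) = 'X * g - g.[1]%:P.
Proof.
rewrite /Delta; rewrite Pdiv.IdomainUnit.divpK ?lead_coefXsubC ?unitr1 //.
by rewrite dvdp_XsubCl /root !hornerE subrr.
Qed.

(* For gs = [:: g_1; ...; g_m] with m >= 1 this is
   x f Delta(g_1 Delta(g_2 ... Delta(g_m))); the innermost factor 1 is only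
   there to start the iteration. *)
Definition Bop (f : {poly int}) (gs : seq {poly int}) : {poly int} :=
  'X * f * foldr (fun g d => Delta (g * d)) 1 gs.

Inductive bintree := BEmpty | BNode of bintree & bintree.

Inductive rotation : bintree -> bintree -> Prop :=
| rotation_root A B C :
    rotation (BNode (BNode A B) C) (BNode A (BNode B C))
| rotation_left l l' r : rotation l l' -> rotation (BNode l r) (BNode l' r)
| rotation_right l r r' : rotation r r' -> rotation (BNode l r) (BNode l r').

Definition tamari : bintree -> bintree -> Prop :=
  clos_refl_trans bintree rotation.

Fixpoint bsize (t : bintree) : nat :=
  if t is BNode l r then (bsize l + bsize r).+1 else 0.

Fixpoint bleft (t : bintree) : nat :=
  if t is BNode l _ then (bleft l).+1 else 0.

(* [graft s t] makes s the left child of the leftmost node of t. *)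
Fixpoint graft (s t : bintree) : bintree :=
  if t is BNode l r then BNode (graft s l) r else s.

(* [mright [:: T_(R_i); ...; T_(R_m)]] is the tree G_i. *)
Fixpoint mright (ts : seq bintree) : bintree :=
  match ts with
  | [::] => BEmpty
  | [:: t] => t
  | t :: ts' => graft (BNode BEmpty (mright ts')) t
  end.

Definition mcompose (tl : bintree) (tr : seq bintree) : bintree :=
  BNode tl (mright tr).

Inductive is_mbinary (m : nat) : bintree -> Prop :=
| mbinary_empty : is_mbinary m BEmpty
| mbinary_node (tl : bintree) (tr : 'I_m -> bintree) :
    is_mbinary m tl -> (forall i, is_mbinary m (tr i)) ->
    is_mbinary m (mcompose tl [seq tr i | i : 'I_m]).

(* (m+1)-ary trees: in [ANode TL TR], [TR i] is the subtree T_(R_(i+1)). *)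
Unset Elimination Schemes.
Inductive ary (m : nat) := AEmpty | ANode of ary m & {ffun 'I_m -> ary m}.
Set Elimination Schemes.

Arguments AEmpty {m}.

Lemma ary_ind (m : nat) (P : ary m -> Prop) :
  P AEmpty ->
  (forall TL (TR : {ffun 'I_m -> ary m}),
     P TL -> (forall i, P (TR i)) -> P (ANode TL TR)) ->
  forall T, P T.
Proof.
move=> P0 PN; fix IH 1 => -[|TL TR]; first exact: P0.
by apply: PN => [|i]; apply: IH.
Qed.

Fixpoint anodes (m : nat) (T : ary m) : nat :=
  if T is ANode TL TR
  then (anodes TL + sumn [seq anodes (TR i) | i : 'I_m]).+1 else 0.

Fixpoint aleft (m : nat) (T : ary m) : nat :=
  if T is ANode TL _ then (aleft TL).+1 else 0.

Fixpoint to_mbin (m : nat) (T : ary m) : bintree :=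
  if T is ANode TL TR
  then mcompose (to_mbin TL) [seq to_mbin (TR i) | i : 'I_m] else BEmpty.

Fixpoint Bpoly (m : nat) (T : ary m) : {poly int} :=
  if T is ANode TL TR
  then Bop (Bpoly TL) [seq Bpoly (TR i) | i : 'I_m] else 1.

(* Ballot paths as words: true is the vertical step 1, false the horizontal
   step 0. *)
Fixpoint ballot_path (m : nat) (T : ary m) : seq bool :=
  if T is ANode TL TR
  then ballot_path TL ++ true ::
         flatten (rev [seq rcons (ballot_path (TR i)) false | i : 'I_m])
  else [::].

(* The point reached after k steps is (number of false, number of true) among
   the first k letters; it lies on y = x / m iff x = m y.  The starting point
   k = 0 is left out. *)
Definition contacts (m : nat) (w : seq bool) : nat :=
  count (fun k => count_mem false (take k w) == (m * count_mem true (take k w))%N)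
        (iota 1 (size w)).

(* [to_mbin] is a bijection from (m+1)-ary trees with n nodes onto m-binary
   trees of size n * m, preserving the length of the leftmost branch. *)
Lemma bsize_graft s t : bsize (graft s t) = (bsize s + bsize t)%N.
Proof. by elim: t => [|l IHl r _] //=; rewrite ?addn0 // IHl addnS addnA. Qed.

Lemma bsize_mright ts :
  bsize (mright ts) = (sumn (map bsize ts) + (size ts).-1)%N.
Proof.
elim: ts => [|t [|u ts] IH] //=; first by rewrite !addn0.
by rewrite bsize_graft /= add0n IH /= addSn addnS addnC addnA.
Qed.

Lemma bsize_to_mbin (m : nat) (T : ary m) :
  (0 < m)%N -> bsize (to_mbin T) = (anodes T * m)%N.
Proof.
move=> m0; elim: T => [|TL TR IHL IHR] //=.
rewrite bsize_mright IHL size_image card_ord -map_comp.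
rewrite mulSn mulnDl addnA -addnS prednK // [RHS]addnC.
congr (_ + _ + _)%N; rewrite /image_mem.
by elim: (enum _) => [|i s IH] //=; rewrite IHR IH mulnDl.
Qed.

Lemma bleft_to_mbin (m : nat) (T : ary m) : bleft (to_mbin T) = aleft T.
Proof. by elim: T => [|TL TR IHL _] //=; rewrite IHL. Qed.

Lemma is_mbinaryP (m : nat) (t : bintree) :
  is_mbinary m t <-> exists T : ary m, to_mbin T = t.
Proof.
split=> [|[T <-]]; last first.
  by elim: T => [|TL TR IHL IHR] /=; [left|right].
elim=> [|tl tr _ [TL <-] _ /choice[TR eTR]]; first by exists AEmpty.
exists (ANode TL [ffun i => TR i]) => /=; congr mcompose.
by apply: eq_map => i; rewrite ffunE eTR.
Qed.

Lemma graft_inj g g' t t' :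
  graft (BNode BEmpty g) t = graft (BNode BEmpty g') t' -> g = g' /\ t = t'.
Proof.
elim: t t' => [|l IHl r _] [|l' r'] //=.
- by case=> ->.
- by case; case: l'.
- by case; case: l {IHl}.
- by case=> /IHl[-> ->] ->.
Qed.

Lemma mright_inj ts us :
  size ts = size us -> mright ts = mright us -> ts = us.
Proof.
elim: ts us => [|t [|t' ts] IH] [|u [|u' us]] //=; first by move=> _ ->.
by case=> eqs /graft_inj[eqr ->]; rewrite (IH (u' :: us)) //= eqs.
Qed.

Lemma to_mbin_inj (m : nat) : injective (@to_mbin m).
Proof.
elim=> [|TL TR IHL IHR] [|TL' TR'] //= [/IHL-> /mright_inj eqR].
congr ANode; apply/ffunP => i; apply: IHR.
have/eq_in_map := eqR (etrans (size_map _ _) (esym (size_map _ _))).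
by apply; rewrite mem_enum.
Qed.

(* Countability of (m+1)-ary trees, and finiteness of those with n nodes. *)
Fixpoint ary_encode (m : nat) (T : ary m) : GenTree.tree unit :=
  if T is ANode TL TR
  then GenTree.Node 1 (ary_encode TL :: [seq ary_encode (TR i) | i : 'I_m])
  else GenTree.Node 0 [::].

Fixpoint ary_decode (m : nat) (c : GenTree.tree unit) : ary m :=
  if c is GenTree.Node _ (cl :: cr)
  then let s := [seq ary_decode m d | d <- cr] in
       ANode (ary_decode m cl) [ffun i : 'I_m => nth AEmpty s i]
  else AEmpty.

Lemma ary_encodeK (m : nat) : cancel (@ary_encode m) (@ary_decode m).
Proof.
elim=> [|TL TR IHL IHR] //=; rewrite IHL; congr ANode.
apply/ffunP => i; rewrite ffunE -map_comp (nth_map i) ?size_enum_ord //=.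
by rewrite nth_ord_enum IHR.
Qed.

HB.instance Definition _ (m : nat) :=
  Countable.copy (ary m) (can_type (@ary_encodeK m)).

Record nary (m n : nat) :=
  NAry { nary_tree :> ary m; _ : anodes nary_tree == n }.

HB.instance Definition _ (m n : nat) := [isSub for @nary_tree m n].
HB.instance Definition _ (m n : nat) := [Countable of nary m n by <:].

Fixpoint ary_upto (m h : nat) : finType :=
  if h is h'.+1
  then option (ary_upto m h' * {ffun 'I_m -> ary_upto m h'})%type else unit.

Fixpoint ary_of_upto (m h : nat) : ary_upto m h -> ary m :=
  if h is h'.+1 return ary_upto m h -> ary m
  then fun o => if o is Some (l, r)
                then ANode (ary_of_upto l) [ffun i => ary_of_upto (r i)]
                else AEmpty
  else fun _ => AEmpty.

Lemma ary_uptoP (m h : nat) (T : ary m) :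
  (anodes T <= h)%N -> exists c : ary_upto m h, ary_of_upto c = T.
Proof.
elim: h T => [|h IH] [|TL TR] //=; try by exists tt.
  by exists None.
rewrite ltnS => le_h.
have [|l <-] := IH TL; first exact: leq_trans (leq_addr _ _) le_h.
have /choice[r er] : forall i, exists c : ary_upto m h, ary_of_upto c = TR i.
  move=> i; apply: IH; apply: leq_trans le_h; apply: leq_trans (leq_addl _ _).
  by rewrite sumnE big_image (bigD1 i) //= leq_addr.
exists (Some (l, [ffun i => r i])) => /=; congr ANode.
by apply/ffunP => i; rewrite !ffunE er.
Qed.

Definition nary_enum (m n : nat) : seq (nary m n) :=
  undup (pmap insub [seq ary_of_upto c | c : ary_upto m n]).

Lemma nary_enumP (m n : nat) : Finite.axiom (nary_enum m n).
Proof.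
apply: Finite.uniq_enumP => [|T]; first exact: undup_uniq.
rewrite mem_undup mem_pmap_sub inE.
have [|c eqT] := @ary_uptoP m n T; first by rewrite (eqP (valP T)).
by rewrite -[\val T]/(nary_tree T) -eqT image_f.
Qed.

HB.instance Definition _ (m n : nat) :=
  isFinite.Build (nary m n) (@nary_enumP m n).

(* The m-Tamari order, transported to (m+1)-ary trees with n nodes. *)
Definition mtamari (m n : nat) : rel (nary m n) :=
  fun T U => `[< tamari (to_mbin T) (to_mbin U) >].

(* Main.v *)
Require Import Defs.
From mathcomp Require Import all_boot all_order all_algebra.
From mathcomp Require Import boolp zify.
From Stdlib Require Import Relation_Operators.

Set Implicit Arguments.
Unset Strict Implicit.
Unset Printing Implicit Defensive.

Import GRing.Theory.
Local Open Scope ring_scope.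

(** The idea is to describe lower sets of the Tamari order structurally.

    A rotation down at the root of a tree moves the root of its right subtree
    above it, onto the left branch.  The trees below [BNode l r] are exactly
    those obtained from some l' below l and some r' below r by cutting
    the left branch of r' at one of its edges, r' = [graft b a], keeping the
    bottom part b as right subtree of the root and moving the top part a above
    the root: the result is [graft (BNode l' b) a] (lemma [tamari_le_node]).
    A left branch with k nodes can be cut at k + 1 places, leaving 0, ..., k
    nodes in the top part, and 1 + x + ... + x^k is exactly Delta(x^k); this is
    the source of the operator Delta.  The trees below [graft s t] are the
    [graft s' t'] with s' below s and t' below t (lemma [tamari_le_graft]).

    For an (m+1)-ary tree T with subtrees L, R_1, ..., R_m, the two facts
    applied alternately along the right part G_1, ..., G_m of its m-binary tree
    show that the trees below T arise as follows.  Choose U_m below R_m and cut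
    it; choose U_(m-1) below R_(m-1), graft the top part of the previous cut at
    the bottom of its left branch, and cut the resulting tree; and so on up to
    R_1.  The bottom parts are the new right subtrees, the last top part goes
    above the root, and the left subtree is any tree below L.  Grafting adds
    the numbers of nodes on the left branches, so each graft multiplies
    generating functions and each cut applies Delta: this is the recursion of
    [Bop].  Every cut of an m-binary tree along its left branch comes from a
    cut of the (m+1)-ary tree (lemma [to_mbin_graftP]), so the whole
    description stays within (m+1)-ary trees.

    The construction is carried out as a list [low T]; [mem_low] identifies its
    elements, [uniq_low] shows that every tree is produced once, because the
    sizes of the pieces are prescribed, and [sum_low] computes its generating
    function.

    For ballot paths, a tree with left subtree L has path W_L followed by an
    arch 1 W_(R_m) 0 ... W_(R_1) 0, which starts on the line y = x / m and comes
    back to it only at its last step: the initial step climbs by m levels,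
    and each of the m blocks W_(R_i) 0 descends by one level in all, its last
    step being the one that does it.
    So each node of the leftmost branch contributes one contact. *)

(** * The Tamari order: basic properties *)

Lemma tamari_refl t : tamari t t.
Proof. exact: rt_refl. Qed.

Lemma tamari_trans u t s : tamari s t -> tamari t u -> tamari s u.
Proof. exact: rt_trans. Qed.

(** Induction down a lower set: a property that passes from t to every tree
    which rotates to t holds on the whole lower set of any tree having it. *)
Lemma tamari_closed (P : bintree -> Prop) :
  (forall u t, rotation u t -> P t -> P u) ->
  forall u t, tamari u t -> P t -> P u.
Proof.
by move=> Prot u t; elim=> {u t} [u t /Prot|//|u s t _ IHus _ IHst /IHst/IHus].
Qed.

Lemma tamari_map (f : bintree -> bintree) :
  (forall u t, rotation u t -> rotation (f u) (f t)) ->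
  forall u t, tamari u t -> tamari (f u) (f t).
Proof.
move=> fR u t; elim=> {u t} [u t /fR|u|u s t _ us _ st].
- exact: rt_step.
- exact: rt_refl.
- exact: tamari_trans us st.
Qed.

Lemma tamari_node l l' r r' :
  tamari l l' -> tamari r r' -> tamari (BNode l r) (BNode l' r').
Proof.
move=> ll rr; apply: (@tamari_trans _ (BNode l' r)).
  by apply: (tamari_map (f := BNode^~ r)) ll => u t; apply: rotation_left.
by apply: (tamari_map (f := BNode l')) rr => u t; apply: rotation_right.
Qed.

Lemma bsize_tamari u t : tamari u t -> bsize u = bsize t.
Proof.
elim=> {u t} [u t|//|u s t _ -> _ -> //].
by elim=> {u t} [A B C|l l' r _ IH|l r r' _ IH] /=; lia.
Qed.

Lemma tamari_empty u : tamari u BEmpty -> u = BEmpty.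
Proof. by move/bsize_tamari; case: u. Qed.

Lemma graft0 t : graft BEmpty t = t.
Proof. by elim: t => //= l -> r _. Qed.

Lemma graftA a b c : graft (graft a b) c = graft a (graft b c).
Proof. by elim: c => //= l -> r _. Qed.

Lemma rotation_graft s t t' :
  rotation t t' -> rotation (graft s t) (graft s t').
Proof. by elim=> *; constructor. Qed.

Lemma tamari_graft s s' t t' :
  tamari s s' -> tamari t t' -> tamari (graft s t) (graft s' t').
Proof.
move=> ss tt; apply: (@tamari_trans _ (graft s t')).
  by apply: tamari_map tt => u v; apply: rotation_graft.
elim: {tt} t' => //= l IHl r _.
exact: tamari_node IHl (tamari_refl r).
Qed.

(** * Lower sets of binary trees *)

(** A rotation that produces [graft s t] takes place within s or within t.  The
    parent-child pairs that it creates are a node x with its right child y, and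
    y with its left child; none of them lies on the left branch through which s
    is attached to t. *)
Lemma rotation_to_graft u s t :
  rotation u (graft s t) ->
  (exists2 s', rotation s' s & u = graft s' t) \/
  (exists2 t', rotation t' t & u = graft s t').
Proof.
elim: t u => [|l IHl r _] u /= rot; first by left; exists u.
inversion rot as [A B C eu [eA er]|l1 l2 r1 rotl eu [el er]
                 |l1 r1 r2 rotr eu [el er]]; subst.
- by right; exists (BNode (BNode l B) C); first constructor.
- have [[s' rs ->]|[t' rt ->]] := IHl _ rotl; first by left; exists s'.
  by right; exists (BNode t' r); first constructor.
- by right; exists (BNode l r1); first constructor.
Qed.

Lemma tamari_le_graft u s t :
  tamari u (graft s t) <->
  exists s' t', [/\ u = graft s' t', tamari s' s & tamari t' t].
Proof.
split=> [le_u|[s' [t' [-> ss tt]]]]; last exact: tamari_graft.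
apply: (tamari_closed (P := fun u =>
  exists s' t', [/\ u = graft s' t', tamari s' s & tamari t' t]) _ le_u);
  last first.
  by exists s, t; split; try exact: tamari_refl.
move=> {le_u}u v rot [s' [t' [eq ss tt]]].
move: rot; rewrite eq => /rotation_to_graft[[s'' rs ->]|[t'' rt ->]].
  exists s'', t'; split=> //; apply: tamari_trans ss; exact: rt_step.
exists s', t''; split=> //; apply: tamari_trans tt; exact: rt_step.
Qed.

(** The nodes of a come down one by one to the right of the root, each by one
    rotation. *)
Lemma tamari_unroll l b a : tamari (graft (BNode l b) a) (BNode l (graft b a)).
Proof.
elim: a => [|a1 IH a2 _] /=; first exact: tamari_refl.
apply: tamari_trans (tamari_node IH (tamari_refl a2)) _.
by apply: rt_step; constructor.
Qed.

(** Going down from [graft (BNode l' b) a], the only rotation that does not stay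
    within l', b or a breaks the edge from the node on top of l' to its right
    child.  It moves the root of b, with its right subtree, from the top of b
    to the bottom of a, which leaves [graft b a] unchanged. *)
Lemma tamari_le_node u l r :
  tamari u (BNode l r) <->
  exists l' b a,
    [/\ u = graft (BNode l' b) a, tamari l' l & tamari (graft b a) r].
Proof.
split=> [le_u|[l' [b [a [-> ll ba]]]]]; last first.
  exact: tamari_trans (tamari_unroll _ _ _) (tamari_node ll ba).
apply: (tamari_closed (P := fun u => exists l' b a,
  [/\ u = graft (BNode l' b) a, tamari l' l & tamari (graft b a) r]) _ le_u);
  last first.
  by exists l, r, BEmpty; split; try exact: tamari_refl.
move=> {le_u}u v rot [l' [b [a [eq ll ba]]]].
move: rot; rewrite eq => /rotation_to_graft[[s rs ->]|[a' ra ->]]; last first.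
  exists l', b, a'; split=> //; apply: tamari_trans ba; apply: rt_step.
  exact: rotation_graft.
inversion rs as [A B C es [eA er]|l1 l2 r1 rotl es [el er]
                 |l1 r1 r2 rotr es [el er]]; subst.
- (* The root of b leaves B behind and carries C to the bottom of a. *)
  exists l', B, (graft (BNode BEmpty C) a).
  by rewrite -!graftA.
- exists l1, b, a; split=> //; apply: tamari_trans ll; exact: rt_step.
- exists l', r1, a; split=> //; apply: tamari_trans ba.
  by apply: tamari_graft; [apply: rt_step|apply: tamari_refl].
Qed.

(** One step along the sequence G_1, ..., G_m.  The tree a is the part that has
    been moved above the root; it has to be obtained from the part a' moved up
    from the next subtrees, grafted below some t' under the tree t, by cutting
    off u.  For empty us and ts the condition on a' forces it to be empty. *)
Lemma tamari_le_mright_cons u us a t ts :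
  size us = size ts ->
  tamari (graft (mright (u :: us)) a) (mright (t :: ts)) <->
  exists a' t', [/\ graft u a = graft a' t', tamari t' t &
                    tamari (graft (mright us) a') (mright ts)].
Proof.
case: us ts => [|u' us] [|t' ts] // eq_size.
  rewrite /=; split=> [le_t|[a' [t' [-> tt]]]].
    exists BEmpty, (graft u a); rewrite graft0; split=> //; exact: tamari_refl.
  by rewrite graft0 => /tamari_empty->; rewrite graft0.
rewrite -[mright (u :: _)]/(graft (BNode BEmpty (mright (u' :: us))) u).
rewrite -[mright (t :: _)]/(graft (BNode BEmpty (mright (t' :: ts))) t).
move: (mright (u' :: us)) (mright (t' :: ts)) => {u' us t' ts eq_size}g g'.
rewrite graftA; split=> [/tamari_le_graft[s [t' [eq + tt]]]|].
  move=> /tamari_le_node[l [b [a' [es /tamari_empty el ba]]]].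
  move: eq; rewrite {}es {}el graftA => /graft_inj[-> eq].
  by exists a', t'.
case=> [a' [t' [-> tt ga]]]; rewrite -graftA; apply: tamari_graft => //.
by apply/tamari_le_node; exists BEmpty, g, a'; split=> //; apply: tamari_refl.
Qed.

(** * Enumeration of the lower set of an (m+1)-ary tree *)

Section Ary.

Variable m : nat.
Implicit Types (S T U A L : ary m) (us : seq (ary m)).

Fixpoint agraft S T : ary m :=
  if T is ANode TL TR then ANode (agraft S TL) TR else S.

Lemma to_mbin_agraft S T : to_mbin (agraft S T) = graft (to_mbin S) (to_mbin T).
Proof. by elim: T => //= L R -> _. Qed.

Lemma aleft_agraft S T : aleft (agraft S T) = (aleft S + aleft T)%N.
Proof. by elim: T => [|L R IH _] /=; lia. Qed.

Lemma anodes_agraft S T : anodes (agraft S T) = (anodes S + anodes T)%N.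
Proof. by elim: T => [|L R IH _] /=; lia. Qed.

(** The left branches of an (m+1)-ary tree and of its m-binary tree have the
    same nodes, so both trees are cut at the same places. *)
Lemma to_mbin_graftP T s t :
  to_mbin T = graft s t ->
  exists S A, [/\ T = agraft S A, to_mbin S = s & to_mbin A = t].
Proof.
elim: t T => [|l IHl r _] T /=; first by exists T, AEmpty.
case: T => //= TL TR [/IHl[S [A [-> eS eA]]] er].
by exists S, (ANode A TR); split=> //=; rewrite /mcompose eA er.
Qed.

Lemma agraft_inj_size A T A' T' :
  anodes T = anodes T' -> agraft A T = agraft A' T' -> A = A' /\ T = T'.
Proof.
elim: T T' => [|L R IH _] [|L' R'] //= [eq_size] [eqL eqR]; move: eq_size.
by rewrite eqR => /addIn/IH/(_ eqL)[-> ->].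
Qed.

Lemma agraft_node_inj L R A L' R' A' :
  anodes L = anodes L' -> agraft (ANode L R) A = agraft (ANode L' R') A' ->
  [/\ L = L', R = R' & A = A'].
Proof.
move=> eq_size; elim: A A' => [|B Q IH _] [|B' Q'] /= [].
- by move=> -> ->.
- move=> eqL; move: eq_size; rewrite eqL anodes_agraft /=; lia.
- move=> eqL; move: eq_size; rewrite -eqL anodes_agraft /=; lia.
- by move=> /IH[-> -> ->] ->.
Qed.

Fixpoint cuts U : seq (ary m * ary m) :=
  (U, AEmpty) ::
  if U is ANode L R then [seq (c.1, ANode c.2 R) | c <- cuts L] else [::].

Lemma mem_cuts U S A : ((S, A) \in cuts U) = (U == agraft S A).
Proof.
elim: U S A => [|L R IH _] S A.
  by rewrite inE xpair_eqE; case: A => [|A Q]; rewrite ?andbF ?andbT // eq_sym.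
rewrite [cuts _]/= inE; case: A => [|A Q] /=.
  rewrite xpair_eqE eqxx andbT eq_sym; case: eqP => //= _.
  by apply/mapP => -[].
rewrite xpair_eqE andbF /=; apply/mapP/eqP => [[[S' A'] /= cLA [-> -> ->]]|].
  by move: cLA; rewrite IH => /eqP->.
by case=> eL ->; exists (S, A); rewrite // IH eL.
Qed.

Lemma uniq_cuts U : uniq (cuts U).
Proof.
elim: U => [|L R IH _] //; rewrite [cuts _]/= cons_uniq map_inj_uniq ?IH.
  by rewrite andbT; apply/mapP => -[].
by move=> [S A] [S' A'] /= [-> ->].
Qed.

(** Given the lower sets of R_1, ..., R_m, the possible pairs made of the new
    right subtrees and of the part that moves above the root.  It is processed
    from R_m, which receives nothing from below, hence the initial empty tree;
    p ranges over the pairs of subtrees already cut off and of the tree to be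
    cut next. *)
Fixpoint low_right (lss : seq (seq (ary m))) : seq (seq (ary m) * ary m) :=
  if lss is ls :: lss' then
    [seq (c.1 :: p.1, c.2)
       | p <- [seq (q.1, agraft q.2 t) | q <- low_right lss', t <- ls],
         c <- cuts p.2]
  else [:: ([::], AEmpty)].

(** The default value is never reached in [low]: the sequences that occur there
    have m entries, by [size_low_right]. *)
Definition anode_seq L us : ary m := ANode L [ffun i : 'I_m => nth AEmpty us i].

Fixpoint low T : seq (ary m) :=
  if T is ANode TL TR then
    [seq agraft (anode_seq L q.1) q.2
       | L <- low TL, q <- low_right [seq low (TR i) | i : 'I_m]]
  else [:: AEmpty].

Lemma mem_low_right_cons u us A ls lss :
  (u :: us, A) \in low_right (ls :: lss) <->
  exists A' T, [/\ agraft u A = agraft A' T, T \in ls &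
                   (us, A') \in low_right lss].
Proof.
split=> [/allpairsPdep[p [[S B] [/allpairsP[[[us' A'] T] /=]]]]|].
  case=> q_low T_ls ->; rewrite mem_cuts => /eqP eq [-> -> ->].
  by exists A', T.
case=> A' [T [eq T_ls q_low]].
apply/allpairsPdep; exists (us, agraft A' T), (u, A); split=> //.
  by apply/allpairsP; exists ((us, A'), T).
by rewrite mem_cuts eq.
Qed.

Lemma size_low_right us A lss :
  (us, A) \in low_right lss -> size us = size lss.
Proof.
elim: lss us A => [|ls lss IH] [|u us] A //=.
  by move=> /allpairsPdep[? [? []]].
by move=> /mem_low_right_cons[A' [T [_ _ /IH->]]].
Qed.

(** Iteration of [tamari_le_mright_cons].  The hypothesis on ts is what the
    induction on trees provides when ts lists the subtrees of a node. *)
Lemma low_rightP (ts : seq (ary m)) us A :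
  {in ts, forall T U, U \in low T <-> tamari (to_mbin U) (to_mbin T)} ->
  size us = size ts ->
  (us, A) \in low_right (map low ts) <->
  tamari (graft (mright (map (@to_mbin m) us)) (to_mbin A))
         (mright (map (@to_mbin m) ts)).
Proof.
elim: ts us A => [|t ts IH] [|u us] A //= lowP.
  rewrite graft0 => _; rewrite inE; split=> [/eqP[->]|/tamari_empty].
    exact: tamari_refl.
  by case: A.
case=> eq_size.
have {}IH B := IH us B (sub_in1 (mem_behead (s := t :: ts)) lowP) eq_size.
have eq_size' : size (map (@to_mbin m) us) = size (map (@to_mbin m) ts).
  by rewrite !size_map.
apply: iff_trans (iff_sym (tamari_le_mright_cons _ _ _ eq_size')).
rewrite -/(low_right (low t :: map low ts)).
apply: iff_trans (mem_low_right_cons _ _ _ _ _) _.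
split=> [[A' [T [eq Tt /IH le_us]]]|[a' [t' [eq tt le_us]]]].
  exists (to_mbin A'), (to_mbin T); rewrite -!to_mbin_agraft eq; split=> //.
  by apply/lowP; rewrite ?mem_head.
move: eq; rewrite -to_mbin_agraft => /to_mbin_graftP[A' [T [eq eA eT]]].
exists A', T; split=> //; first by apply/lowP; rewrite ?mem_head ?eT.
by apply/IH; rewrite ?eA.
Qed.

Lemma to_mbin_anode_seq L us :
  size us = m ->
  to_mbin (anode_seq L us) = mcompose (to_mbin L) (map (@to_mbin m) us).
Proof.
move=> size_us /=; congr mcompose.
apply: (@eq_from_nth _ BEmpty); rewrite ?size_map -?enumT ?size_enum_ord //.
move=> i lt_im; rewrite (nth_map (Ordinal lt_im)) ?size_enum_ord // ffunE.
by rewrite nth_enum_ord // (nth_map AEmpty) ?size_us.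
Qed.

Lemma anode_seq_image L (R : {ffun 'I_m -> ary m}) :
  anode_seq L [seq R i | i : 'I_m] = ANode L R.
Proof.
congr ANode; apply/ffunP => i; rewrite ffunE.
by rewrite (nth_map i) ?size_enum_ord // nth_ord_enum.
Qed.

Lemma mem_low T U : U \in low T <-> tamari (to_mbin U) (to_mbin T).
Proof.
elim: T U => [|TL TR IHL IHR] U.
  rewrite /= inE; split=> [/eqP->|/tamari_empty]; first exact: tamari_refl.
  by case: U.
have lowR us A : size us = m ->
    (us, A) \in low_right [seq low (TR i) | i : 'I_m] <->
    tamari (graft (mright (map (@to_mbin m) us)) (to_mbin A))
           (mright [seq to_mbin (TR i) | i : 'I_m]).
  move=> size_us; rewrite /image_mem (map_comp low TR).
  rewrite (map_comp (@to_mbin m) TR); apply: low_rightP.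
    by move=> _ /mapP[i _ ->]; apply: IHR.
  by rewrite size_map size_enum_ord.
rewrite /=; split=> [/allpairsP[[L [us A]] /= [/IHL leL low_us ->]]|].
  have size_us : size us = m.
    by rewrite (size_low_right low_us) size_map size_enum_ord.
  apply/tamari_le_node; exists (to_mbin L), (mright (map (@to_mbin m) us)).
  exists (to_mbin A); split=> //; last exact/lowR.
  by rewrite to_mbin_agraft to_mbin_anode_seq.
move=> /tamari_le_node[l [b [a [/to_mbin_graftP[S [A [-> eS <-]]] leL leR]]]].
case: S eS => //= L R [eL eb]; apply/allpairsP.
exists (L, ([seq R i | i : 'I_m], A)).
split=> /=; last by rewrite anode_seq_image.
  by apply/IHL; rewrite eL.
apply/lowR; first by rewrite size_map size_enum_ord.
by rewrite /image_mem -map_comp eb.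
Qed.

(** An entry (u :: us, A) determines the tree [agraft u A] that was cut.  That
    tree is the graft of the previous top part below some T in ls, and since
    all elements of ls have the same size, it determines both. *)
Lemma uniq_low_right (lss : seq (seq (ary m))) :
  {in lss, forall ls, uniq ls /\ {in ls &, forall T U, anodes T = anodes U}} ->
  uniq (low_right lss).
Proof.
elim: lss => [|ls lss IH] //= lssP.
have [uniq_ls size_ls] := lssP ls (mem_head _ _).
apply: allpairs_uniq_dep => [|p _|].
- apply: allpairs_uniq => //.
    by apply: IH => ls' ls'_in; apply: lssP; rewrite inE ls'_in orbT.
  move=> [[us A] T] [[us' A'] T'] /allpairsP[[q t] /= [_ Tls [_ eT]]].
  move=> /allpairsP[[q' t'] /= [_ T'ls [_ eT']]] /= [-> eq].
  by subst t t'; have [-> ->] := agraft_inj_size (size_ls _ _ Tls T'ls) eq.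
- exact: uniq_cuts.
move=> p p' /allpairsPdep[[us U] [[u A] [_ cU ->]]].
move=> /allpairsPdep[[us' U'] [[u' A'] [_ cU' ->]]] /= [eu eus eA].
by move: cU cU'; rewrite !mem_cuts /= eu eus eA => /eqP-> /eqP->.
Qed.

Lemma anodes_tamari T U :
  (0 < m)%N -> tamari (to_mbin T) (to_mbin U) -> anodes T = anodes U.
Proof.
move=> m0 /bsize_tamari/eqP; rewrite !bsize_to_mbin // eqn_pmul2r //.
by move/eqP.
Qed.

(** The size of the left subtree tells where on the left branch of
    [agraft (anode_seq L us) A] the node coming from the root is. *)
Lemma uniq_low T : (0 < m)%N -> uniq (low T).
Proof.
move=> m0.
have size_low T0 U U' : U \in low T0 -> U' \in low T0 -> anodes U = anodes U'.
  by move=> /mem_low/(anodes_tamari m0)-> /mem_low/(anodes_tamari m0)->.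
elim: T => [|TL TR IHL IHR] //=; apply: allpairs_uniq => //.
  apply: uniq_low_right => _ /mapP[i _ ->]; split; first exact: IHR.
  exact: size_low.
move=> [L [us A]] [L' [us' A']] /allpairsP[[L1 [us1 A1]] /= [L_in us_in]].
case=> ? ? ?; subst L1 us1 A1.
move=> /allpairsP[[L1 [us1 A1]] /= [L'_in us'_in [? ? ?]]]; subst L1 us1 A1.
have sizeP vs B : (vs, B) \in low_right [seq low (TR i) | i : 'I_m] ->
    size vs = m.
  by move/size_low_right->; rewrite size_map size_enum_ord.
move=> /agraft_node_inj[|-> eq_us ->]; first exact: size_low L_in L'_in.
suff -> : us = us' by [].
apply: (@eq_from_nth _ AEmpty).
  by rewrite (sizeP _ _ us_in) (sizeP _ _ us'_in).
move=> i; rewrite (sizeP _ _ us_in) => lt_im.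
by have /ffunP/(_ (Ordinal lt_im)) := eq_us; rewrite !ffunE.
Qed.

End Ary.

(** * Generating functions *)

Lemma Delta_unique (g h : {poly int}) :
  h * ('X - 1%:P) = 'X * g - g.[1]%:P -> Delta g = h.
Proof.
by rewrite -DeltaK => /esym; apply: mulIf; rewrite polyXsubC_eq0.
Qed.

Lemma Delta_sum (I : Type) (s : seq I) (f : I -> nat) :
  Delta (\sum_(i <- s) 'X^(f i)) = \sum_(i <- s) \sum_(j < (f i).+1) 'X^j.
Proof.
apply: Delta_unique; rewrite horner_sum rmorph_sum mulr_sumr mulr_suml -sumrB.
apply: eq_bigr => i _; rewrite hornerXn expr1n -exprS.
by rewrite !polyC1 subrX1 mulrC.
Qed.

Section GeneratingFunction.

Variable m : nat.
Implicit Types (U T : ary m) (lss : seq (seq (ary m))).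

Lemma sum_cuts U :
  \sum_(c <- cuts U) 'X^(aleft c.2) =
  \sum_(j < (aleft U).+1) 'X^j :> {poly int}.
Proof.
elim: U => [|L R IH _]; rewrite [cuts _]/= big_cons.
  by rewrite big_nil big_ord1 addr0.
rewrite big_ord_recl big_map; congr (_ + _).
under eq_bigr => c _ do rewrite /= exprS.
rewrite -mulr_sumr IH mulr_sumr; apply: eq_bigr => j _.
by rewrite -exprS.
Qed.

Lemma sum_low_right lss :
  \sum_(q <- low_right lss) 'X^(aleft q.2) =
  foldr (fun g d => Delta (g * d)) 1
    [seq \sum_(T <- ls) 'X^(aleft T) | ls <- lss] :> {poly int}.
Proof.
elim: lss => [|ls lss IH] /=; first by rewrite big_seq1.
rewrite -IH [in RHS]mulrC mulr_suml big_allpairs_dep /=.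
rewrite (eq_bigr (fun p => \sum_(j < (aleft p.2).+1) 'X^j)); last first.
  by move=> p _; apply: sum_cuts.
rewrite -Delta_sum; congr Delta; rewrite big_allpairs_dep.
apply: eq_bigr => q _; rewrite mulr_sumr; apply: eq_bigr => T _.
by rewrite /= aleft_agraft exprD.
Qed.

Lemma sum_low T : \sum_(U <- low T) 'X^(aleft U) = Bpoly T.
Proof.
elim: T => [|TL TR IHL IHR] /=; first by rewrite big_seq1.
rewrite big_allpairs_dep /Bop -IHL.
have -> : [seq Bpoly (TR i) | i : 'I_m] =
    [seq \sum_(U <- ls) 'X^(aleft U) | ls <- [seq low (TR i) | i : 'I_m]].
  by rewrite /image_mem -map_comp; apply: eq_map => i; rewrite /= IHR.
rewrite -sum_low_right -mulrA mulr_suml mulr_sumr; apply: eq_bigr => L _.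
rewrite !mulr_sumr; apply: eq_bigr => q _.
by rewrite aleft_agraft exprD exprS mulrA.
Qed.

End GeneratingFunction.

(** * Contacts of ballot paths *)

Section Contacts.

Variable m : nat.

Definition ups (w : seq bool) : nat := count_mem true w.
Definition downs (w : seq bool) : nat := count_mem false w.

Lemma ups_cat w v : ups (w ++ v) = (ups w + ups v)%N.
Proof. exact: count_cat. Qed.

Lemma downs_cat w v : downs (w ++ v) = (downs w + downs v)%N.
Proof. exact: count_cat. Qed.

Lemma ups_cons b w : ups (b :: w) = (b + ups w)%N.
Proof. by case: b. Qed.

Lemma downs_cons b w : downs (b :: w) = (~~ b + downs w)%N.
Proof. by case: b. Qed.

Definition letter_countE :=
  (ups_cat, downs_cat, ups_cons, downs_cons, mulnDr, muln1, muln0).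

Definition on_line (w : seq bool) : bool := downs w == (m * ups w)%N.

Lemma contactsE w :
  contacts m w = count (fun k => on_line (take k w)) (iota 1 (size w)).
Proof. by []. Qed.

(** The path w reaches, for the first time and at its last step, a level p
    steps 0 lower than the line y = x / m through its starting point.  An empty
    path has this property for p = 0. *)
Definition descends (p : nat) (w : seq bool) : Prop :=
  downs w = (m * ups w + p)%N /\
  forall k, (k < size w)%N -> (downs (take k w) < m * ups (take k w) + p)%N.

Lemma descends_cat p q w v :
  (0 < q)%N -> descends p w -> descends q v -> descends (p + q) (w ++ v).
Proof.
move=> q0 [eqw ltw] [eqv ltv]; split=> [|k].
  by rewrite !letter_countE eqw eqv; lia.
rewrite size_cat take_cat => lt_k.
case: (ltnP k) => [/ltw|le_wk]; first by lia.
have {}/ltv : (k - size w < size v)%N by lia.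
by rewrite !letter_countE eqw; lia.
Qed.

Lemma descends_flatten (ws : seq (seq bool)) :
  {in ws, forall w, descends 1 w} -> descends (size ws) (flatten ws).
Proof.
elim: ws => [|w ws IH] wsP; first by split=> //=; rewrite muln0.
have Pw := wsP w (mem_head _ _).
have {}IH : descends (size ws) (flatten ws).
  by apply: IH => v vws; apply: wsP; rewrite inE vws orbT.
case: ws {wsP} IH => [|v ws] IH; first by rewrite /= cats0.
by rewrite [size _]/= -add1n; apply: descends_cat.
Qed.

Lemma contacts_cat w v :
  on_line w -> contacts m (w ++ v) = (contacts m w + contacts m v)%N.
Proof.
move=> /eqP eqw; rewrite !contactsE size_cat iotaD count_cat; congr addn.
  apply: eq_in_count => k; rewrite mem_iota add1n ltnS => /andP[_ le_kw].
  by rewrite takel_cat.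
rewrite addnC iotaDl count_map; apply: eq_count => k.
rewrite /on_line /= take_cat ltnNge leq_addr /= addKn !letter_countE eqw.
by rewrite eqn_add2l.
Qed.

(** The initial step 1 climbs by m levels, and w comes back to the starting
    level only at its end. *)
Lemma contacts_arch w :
  (0 < m)%N -> descends m w -> contacts m (true :: w) = 1%N.
Proof.
move=> m0 [eqw ltw]; rewrite contactsE [size _]/= -(addn1 (size w)) iotaD.
rewrite count_cat addnC (_ : count _ (iota 1 _) = 0)%N.
  by rewrite /on_line /= take_size !letter_countE eqw [(m + _)%N]addnC eqxx.
apply/eqP; rewrite -leqn0 leqNgt -has_count; apply/hasPn => k.
rewrite mem_iota; case: k => // k /andP[_ lt_k].
have {lt_k}/ltw : (k < size w)%N by lia.
by rewrite /on_line /= !letter_countE; lia.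
Qed.

(** That the path of T never goes below the line is expressed by saying that
    one more step 0 is what makes it cross the line for the first time; in this
    form it applies directly to the blocks W_(R_i) 0 of a larger path. *)
Lemma ballot_pathP (T : ary m) :
  (0 < m)%N ->
  [/\ on_line (ballot_path T), descends 1 (rcons (ballot_path T) false) &
      contacts m (ballot_path T) = aleft T].
Proof.
move=> m0; elim: T => [|TL TR [onL [_ ltL] cL] IHR].
  split=> //; first by rewrite /on_line muln0.
  by split=> [|[|k]] //; rewrite muln0.
rewrite [ballot_path _]/=; set F := flatten _; set L := ballot_path TL.
have dF : descends m F.
  rewrite -{1}[m]size_enum_ord -(size_map (fun i : 'I_m =>
    rcons (ballot_path (TR i)) false)) -size_rev.
  apply: descends_flatten => w; rewrite mem_rev => /mapP[i _ ->].
  by have [] := IHR i.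
have [eqF ltF] := dF; have eqL : downs L = (m * ups L)%N := eqP onL.
have eqT : downs (L ++ true :: F) = (m * ups (L ++ true :: F))%N.
  by rewrite !letter_countE eqL eqF; lia.
split; [exact/eqP| |by rewrite contacts_cat // contacts_arch // cL addn1].
split=> [|k].
  by rewrite -cats1 downs_cat ups_cat eqT (_ : ups [:: false] = 0)%N // addn0.
rewrite size_rcons ltnS => le_k; rewrite -cats1 takel_cat // take_cat.
case: (ltnP k) => [lt_kL|le_Lk].
  move: (ltL k); rewrite size_rcons -cats1 takel_cat; last exact: ltnW.
  by apply; apply: ltnW.
(* Here j is the number of letters taken from F, after the step 1. *)
case def_k: (k - _)%N => [|j]; first by rewrite /= cats0 eqL; lia.
rewrite /= !letter_countE eqL; have [/ltF|le_Fj] := ltnP j (size F).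
  by lia.
by rewrite take_oversize // eqF; lia.
Qed.

End Contacts.

Theorem theorem4p13 (m n : nat) (hm : (0 < m)%N) (T : nary m n) :
  [/\ Bpoly T = \sum_(T' : nary m n | mtamari T' T) 'X^(aleft T'),
      (forall T' : nary m n, contacts m (ballot_path T') = aleft T'),
      Bpoly T = \sum_(T' : nary m n | mtamari T' T)
                  'X^(contacts m (ballot_path T'))
    & (Bpoly T).[1] = #|[set T' : nary m n | mtamari T' T]|%:R].
Proof.
have aleft_contacts (T' : nary m n) : contacts m (ballot_path T') = aleft T'.
  by have [_ _] := ballot_pathP T' hm.
have sum_aleft : Bpoly T = \sum_(T' : nary m n | mtamari T' T) 'X^(aleft T').
  rewrite -sum_low.
  have perm_low : perm_eq (low T)
      (image (@nary_tree m n) [pred T' | mtamari T' T]).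
    apply: uniq_perm; first exact: uniq_low.
      by rewrite map_inj_uniq ?enum_uniq //; apply: val_inj.
    move=> U; apply/idP/imageP => [/mem_low le_UT|[T' /asboolP le_T' ->]].
      have sizeU : anodes U == n.
        by rewrite (anodes_tamari hm le_UT); case: T {le_UT}.
      by exists (NAry sizeU) => //; apply/asboolP.
    exact/mem_low.
  by rewrite (perm_big _ perm_low) big_image.
split=> //.
  by rewrite sum_aleft; apply: eq_bigr => T' _; rewrite aleft_contacts.
rewrite sum_aleft horner_sum -sum1dep_card natr_sum.
by apply: eq_bigr => T' _; rewrite hornerXn expr1n.
Qed.
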